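(* Let $0\leq\mu_r\leq\delta_r$, $0\leq\mu_f\leq\delta_f$, $u\in S$ and $x\in Sol_{RIC}^{\mu_r,\delta_r,\mu_f,\delta_f}(u)$. If $\delta_r\geq\delta_f-\mu_f$ and $\delta_f\geq\delta_r-\mu_r$, then $x\in Sol_{AIC}^{\delta_f-\delta_r+\mu_r,\ \delta_r-\delta_f+\mu_f}$.
   Context: $\mathbf{B}=\{0,1\}$ with Boolean operations $\cdot$ (and), complement $\overline{\ \cdot\ }$, ordered by $0<1$. $S$ is the set of signals: functions $x:\mathbb{R}\to\mathbf{B}$ for which there is a strictly increasing unbounded sequence $t_0<t_1<t_2<\dots$ of reals such that $x$ is constant on $(-\infty,t_0)$ and on each $[t_k,t_{k+1})$; $x(t-0)$ denotes the left limit of $x$ at $t$. For a bounded interval $I$ and $u\in S$, $\bigcap_{\xi\in I}u(\xi)$ equals $1$ iff $u(\xi)=1$ for all $\xi\in I$. For $\delta_r,\delta_f\geq0$, $Sol_{AIC}^{\delta_r,\delta_f}$ is the set of $x\in S$ such that for all $t\in\mathbb{R}$: $\overline{x(t-0)}\cdot x(t)\leq\bigcap_{\xi\in[t,t+\delta_r]}x(\xi)$ and $x(t-0)\cdot\overline{x(t)}\leq\bigcap_{\xi\in[t,t+\delta_f]}\overline{x(\xi)}$. For $0\leq\mu_r\leq\delta_r$, $0\leq\mu_f\leq\delta_f$ and $u\in S$, $Sol_{RIC}^{\mu_r,\delta_r,\mu_f,\delta_f}(u)$ (relative inertial condition) is the set of $x\in S$ such that for all $t\in\mathbb{R}$: $\overline{x(t-0)}\cdot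 x(t)\leq\bigcap_{\xi\in[t-\delta_r,t-\delta_r+\mu_r]}u(\xi)$ and $x(t-0)\cdot\overline{x(t)}\leq\bigcap_{\xi\in[t-\delta_f,t-\delta_f+\mu_f]}\overline{u(\xi)}$. *)

(* Defs.v *)
From mathcomp Require Import all_boot all_order all_algebra.
From mathcomp Require Import all_classical all_reals all_analysis.
Import Order.TTheory GRing.Theory Num.Theory numFieldNormedType.Exports.
Set Implicit Arguments.
Unset Strict Implicit.
Unset Printing Implicit Defensive.
Local Open Scope classical_set_scope.
Local Open Scope ring_scope.

Definition constant_on (R : realType) (A : set R) (x : R -> bool) : Prop :=
  forall s s', A s -> A s' -> x s = x s'.

Definition signal (R : realType) : set (R -> bool) :=
  [set x | exists t : nat -> R,
    [/\ forall k, t k < t k.+1,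
        forall M, exists k, M < t k,
        constant_on `]-oo, t 0%N[ x
      & forall k, constant_on `[t k, t k.+1[ x]].

(* x(t-0); bool carries the discrete topology. The limit exists for every
   signal, see signal_cvg_left. *)
Definition left_lim (R : realType) (x : R -> bool) (t : R) : bool :=
  lim (x s @[s --> t^'-]).

Definition inter_on (R : realType) (I : set R) (u : R -> bool) : bool :=
  `[< forall xi, I xi -> u xi = true >].

Definition Sol_AIC (R : realType) (dr df : R) : set (R -> bool) :=
  [set x | signal x /\ forall t : R,
    (~~ left_lim x t && x t <= inter_on `[t, t + dr] x)%O /\
    (left_lim x t && ~~ x t <= inter_on `[t, t + df] (fun xi => ~~ x xi))%O].

Definition Sol_RIC (R : realType) (mr dr mf df : R) (u : R -> bool) :
    set (R -> bool) :=
  [set x | signal x /\ forall t : R,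
    (~~ left_lim x t && x t <= inter_on `[t - dr, t - dr + mr] u)%O /\
    (left_lim x t && ~~ x t
       <= inter_on `[t - df, t - df + mf] (fun xi => ~~ u xi))%O].

Lemma signal_cvg_left (R : realType) (x : R -> bool) (t : R) :
  signal x -> x s @[s --> t^'-] --> left_lim x t.
Proof.
case=> tt [_ tunb x0 xk].
suff : exists b : bool, x s @[s --> t^'-] --> b.
  by case=> b xb; rewrite /left_lim (cvg_lim (@discrete_hausdorff bool) xb).
have near_const a : a < t -> constant_on `]a, t[ x ->
    exists b : bool, x s @[s --> t^'-] --> b.
  move=> at_ xc; exists (x ((a + t) / 2)).
  apply/discrete_cvg.
  suff : \forall s \near t^'-, x s = x ((a + t) / 2) by [].
  near=> s.
  apply: xc; rewrite /= in_itv /=.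
    by apply/andP; split; near: s; [exact: nbhs_left_gt|exact: nbhs_left_lt].
  by rewrite !midf_lt.
have [k tk] := tunb t.
have {tk} : t <= tt k by exact: ltW.
elim: k => [t0|k IH tSk].
  apply: (near_const (t - 1)); first by rewrite ltrBlDr ltrDl.
  move=> s s'; rewrite /= !in_itv /= => /andP[_ st] /andP[_ s't].
  by apply: x0; rewrite /= in_itv /=; [exact: lt_le_trans t0|exact: lt_le_trans t0].
have [/IH //|tkt] := leP t (tt k).
apply: (near_const _ tkt) => s s'.
rewrite /= !in_itv /= => /andP[ks st] /andP[ks' s't].
by apply: (xk k); rewrite /= in_itv /= ltW //=; exact: lt_le_trans tSk.
Unshelve. all: by end_near.
Qed.

(* Main.v *)
Require Import Defs.
From mathcomp Require Import all_boot all_order all_algebra.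
From mathcomp Require Import all_classical all_reals all_analysis.
From mathcomp Require Import lra.
Import Order.TTheory GRing.Theory Num.Theory numFieldNormedType.Exports.
Local Open Scope classical_set_scope.
Local Open Scope ring_scope.

(** If [x] rises at [t] and then falls at some [t'] with
    [t < t' <= t + df - dr + mr], the relative inertial condition forces [u] to
    be 1 on [[t - dr, t - dr + mr]] and 0 on [[t' - df, t' - df + mf]]; the
    bounds on [t'] and [df - mf <= dr] make these two intervals meet: absurd.
    Since a signal cannot change its value on an interval without a switch in
    the opposite direction, [x] stays 1. The falling case is symmetric. *)

(* Induction on the index of the piece of [x] that contains [b]: at the left end
   of this piece either the left limit differs from [x b], or [x] already takes
   the value [x b] in the previous piece. *)
Lemma signal_switch (R : realType) (x : R -> bool) (a b : R) :
  signal x -> a <= b -> x a != x b ->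
  exists t, [/\ a < t, t <= b, left_lim x t = x a & x t = x b].
Proof.
move=> sx; have [tt [_ tunb x0 xk]] := sx.
have [k] := tunb b.
elim: k b => [|k IH] b btk ab xab.
  have xE : x a = x b by apply: x0; rewrite /= in_itv //=; exact: le_lt_trans btk.
  by rewrite xE eqxx in xab.
have [btk'|tkb] := ltP b (tt k); first exact: IH.
have xbE s : tt k <= s -> s <= b -> x s = x b.
  move=> ks sb; apply: (xk k); rewrite /= in_itv /= ?tkb ?ks //=.
  exact: le_lt_trans btk.
have atk : a < tt k.
  by rewrite ltNge; apply: contra xab => /xbE -> //.
have xtk : x (tt k) = x b by exact: xbE.
have [la|la] := eqVneq (left_lim x (tt k)) (x a); first by exists (tt k).
have lb : left_lim x (tt k) = x b.
  by move: la xab; case: left_lim; case: (x a); case: (x b).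
(* Convergence in a discrete space makes [x] equal to [x b] just left of [tt k]; such a point beyond
   [a] falls under the induction hypothesis. *)
have /discrete_cvg xnear := @signal_cvg_left _ _ (tt k) sx.
have [s [as_ stk xs]] : exists s, [/\ a < s, s < tt k & x s = x b].
  have : \forall s \near (tt k)^'-, [/\ a < s, s < tt k & x s = x b].
    near=> s; split.
    - by near: s; exact: nbhs_left_gt.
    - by near: s; exact: nbhs_left_lt.
    - by rewrite -lb; near: s; exact: xnear.
  by move/filter_ex.
have [|t [at_ ts lt xt]] := IH s stk (ltW as_); first by rewrite xs.
exists t; split=> //; last by rewrite xt.
exact: le_trans ts (le_trans (ltW stk) tkb).
Unshelve. all: by end_near.
Qed.

(** The order on [bool] is implication. *)
Lemma inter_onP (R : realType) (b : bool) (I : set R) (u : R -> bool) :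
  reflect (b -> forall s, I s -> u s) (b <= inter_on I u)%O.
Proof.
rewrite /inter_on leEbool; case: b; last by constructor.
by case: asboolP => uI; constructor=> // /(_ isT)/uI.
Qed.

Lemma itvcc_meet (R : realType) (a b c d : R) :
  a <= b -> c <= d -> a <= d -> c <= b -> exists s, s \in `[a, b] /\ s \in `[c, d].
Proof.
move=> ab cd ad cb; exists (Num.max a c).
by rewrite !in_itv /= !ge_max !le_max !lexx ab cd ad cb orbT.
Qed.

Theorem theorem4p2 (R : realType) (mr dr mf df : R) (u x : R -> bool)
  (hr : 0 <= mr <= dr) (hf : 0 <= mf <= df)
  (hu : signal u) (hx : Sol_RIC mr dr mf df u x)
  (h1 : df - mf <= dr) (h2 : dr - mr <= df) :
  Sol_AIC (df - dr + mr) (dr - df + mf) x.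
Proof.
case: hx => sx ric; split=> // t.
have rise s := elimT (inter_onP _ _ _ _) (ric s).1.
have fall s := elimT (inter_onP _ _ _ _) (ric s).2.
split; apply/inter_onP => xt s; rewrite /= in_itv /= => /andP[ts st].
- apply/negPn/negP => xs; have /andP[_ xt1] := xt.
  have [|t' [tt' t's lt' xt']] := signal_switch _ x t s sx ts.
    by rewrite xt1 (negbTE xs).
  (* [tt'] and [h1] give [t - dr <= t' - df + mf]; [t's] and [st] give [t' - df <= t - dr + mr]. *)
  have [|||| z [zr zf]] :=
    itvcc_meet _ (t - dr) (t - dr + mr) (t' - df) (t' - df + mf); try lra.
  have : ~~ u z by apply: (fall t') zf; rewrite lt' xt' xt1.
  by rewrite (rise t xt z zr).
- apply/negP => xs; have /andP[_ xt0] := xt.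
  have [|t' [tt' t's lt' xt']] := signal_switch _ x t s sx ts.
    by rewrite xs (negbTE xt0).
  (* Here [h2] takes the place of [h1]. *)
  have [|||| z [zf zr]] :=
    itvcc_meet _ (t - df) (t - df + mf) (t' - dr) (t' - dr + mr); try lra.
  have uz : u z by apply: (rise t') zr; rewrite lt' xt' xs xt0.
  by have := fall t xt z zf; rewrite uz.
Qed.
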